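(* Let $l,m\ge 1$ be integers and let $\sigma$ be a face of $\Delta(B_{lm})/S_l\wr S_m$ that omits a single interval $T<S$. Write $S=T\cup S'$ (disjoint union), and suppose that some letter in $S'$ appears with multiplicity greater than one. Then the link $\mathrm{lk}(\sigma)$ in $\Delta(B_{lm})/S_l\wr S_m$ is collapsible.
   Context: $B_n$ is the Boolean algebra of all subsets of $\{1,\dots,n\}$ ordered by inclusion, with $\hat 0=\emptyset$ and $\hat 1=\{1,\dots,n\}$, and $\Delta(B_n)$ is the simplicial complex whose faces are the chains $u_0<\dots<u_i$ of elements of $B_n\setminus\{\hat 0,\hat 1\}$ (the empty chain being the empty face). The wreath product $S_l\wr S_m\subset S_{lm}$ is the subgroup of order $(l!)^m m!$ consisting of the permutations of $\{1,\dots,lm\}$ that preserve the partition of $\{1,\dots,lm\}$ into the $m$ sets (''rows'') $\{il+1,\dots,(i+1)l\}$, $0\le i<m$; that is, it permutes the elements within each row and permutes the rows wholesale. It acts on $B_{lm}$, hence on $\Delta(B_{lm})$. The quotient complex $\Delta(B_{lm})/S_l\wr S_m$ is the regular cell complex whose cells (faces) are the $S_l\wr S_m$-orbits of faces of $\Delta(B_{lm})$, with an orbit contained in another if some representative of the first is contained in a representative of the second. (It is in general not the order complex of the quotient poset.) It is a boolean cell complex: every lower interval in its face poset, which includes the empty face, is a Boolean algebra. The link $\mathrm{lk}(\sigma)$ of a face $\sigma$ is the boolean cell complex whose face poset (including the empty face, which corresponds to $\sigma$) is $\{\rho:\rho\supseteq\sigma\}$. Letters and multiplicity: since the elements of a row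 are interchangeable, each element $il+s$ ($0\le i<m$, $1\le s\le l$) of $\{1,\dots,lm\}$ is recorded by its row, i.e. by the letter $i+1$, so that subsets of $\{1,\dots,lm\}$ are viewed as sub-multisets of $\{1^l,2^l,\dots,m^l\}$ (where $j^l$ denotes $l$ copies of the letter $j$), and faces of the quotient complex are chains of such multisets modulo simultaneous permutation of the letters $1,\dots,m$. The multiplicity of a letter in a subset is the number of elements of that row in the subset. A face $\sigma$ omits a single interval $T<S$ if, for a representative chain of $\sigma$ with $\hat 0$ and $\hat 1$ adjoined, $T<S$ are consecutive elements of this chain and the chain contains an element of every rank (cardinality) in $\{0,\dots,lm\}$ except precisely the ranks strictly between $|T|$ and $|S|$. A boolean cell complex is collapsible if it can be reduced to a single vertex by a sequence of elementary collapses, where an elementary collapse removes a pair of nonempty faces $\tau\subset\rho$ with $\dim\rho=\dim\tau+1$ such that $\rho$ is the only face properly containing $\tau$. *)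

(* Defs.v *)
From mathcomp Require Import all_boot all_fingroup.

Set Implicit Arguments.
Unset Strict Implicit.
Unset Printing Implicit Defensive.

(* A finite cell complex is given by its face poset: the set K of its faces, *)
(* the containment relation le, and the empty face e, which belongs to K.    *)
Section BooleanCellComplex.

Variables (F : finType) (le : rel F) (e : F).
Implicit Types (K L : {set F}) (t r v : F).

Definition properly_contained t r : bool := (t != r) && le t r.

Definition is_vertex K v : bool :=
  [&& v \in K, v != e &
      [forall t in K, properly_contained t v ==> (t == e)]].

(* In a boolean cell complex the faces contained in r form a Boolean algebra *)
(* of rank dim r + 1, whose atoms are the vertices of r. The value on the    *)
(* empty face is junk.                                                       *)
Definition dim K r : nat := #|[set v | is_vertex K v & le v r]|.-1.

Definition elementary_collapse : rel {set F} := fun K L =>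
  [exists t, exists r,
    [&& [&& t \in K, r \in K, t != e & r != e],
        properly_contained t r,
        dim K r == (dim K t).+1,
        [forall s in K, properly_contained t s ==> (s == r)] &
        L == K :\: [set t; r]]].

Definition collapsible K : Prop :=
  exists2 v, is_vertex K v & connect elementary_collapse K [set e; v].

End BooleanCellComplex.

Section QuotientComplex.

Variable n : nat.
Implicit Types (c : {set {set 'I_n}}) (A B s : {set {set {set 'I_n}}}).

Definition proper_chain c : bool :=
  [&& set0 \notin c, setT \notin c &
      [forall u in c, forall v in c, (u \subset v) || (v \subset u)]].

Definition Delta : {set {set {set 'I_n}}} := [set c | proper_chain c].

Variable G : {group 'S_n}.

(* 'P^*^* is the action of permutations on families of subsets of 'I_n. *)
Definition quotient_faces : {set {set {set {set 'I_n}}}} :=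
  orbit ('P^*^*) G @: Delta.

Definition orbit_le : rel {set {set {set 'I_n}}} := fun A B =>
  [exists a in A, exists b in B, a \subset b].

(* The faces of the link of s; its containment relation is orbit_le, and its *)
(* empty face is s.                                                          *)
Definition link s : {set {set {set {set 'I_n}}}} :=
  [set r in quotient_faces | orbit_le s r].

Definition bounded_chain c : {set {set 'I_n}} := [set set0; setT] :|: c.

Definition omits_single_interval s (T S : {set 'I_n}) : Prop :=
  exists2 c, c \in s &
    [/\ T \in bounded_chain c, S \in bounded_chain c, T \proper S,
        forall U, U \in bounded_chain c -> ~~ ((T \proper U) && (U \proper S))
      & forall k, k <= n ->
          (exists2 U, U \in bounded_chain c & #|U| = k)
            <-> ~~ (#|T| < k < #|S|)].

End QuotientComplex.

Section Wreath.

Variables l m : nat.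

(* The ground set {1, ..., lm} and the letters 1, ..., m are numbered from 0. *)
Definition letter_row (i : 'I_m) : {set 'I_(l * m)} :=
  [set x : 'I_(l * m) | i * l <= x < i.+1 * l].

Definition rows : {set {set 'I_(l * m)}} := [set letter_row i | i : 'I_m].

Definition wreath : {group 'S_(l * m)} := 'N(rows | 'P^*)%G.

Definition multiplicity (i : 'I_m) (U : {set 'I_(l * m)}) : nat :=
  #|U :&: letter_row i|.

End Wreath.

(* Main.v *)
Require Import Defs.
From mathcomp Require Import all_boot all_fingroup.

(** The link collapses because its faces, the empty one included, can be
    matched in pairs (t, r), with t contained in r and of dimension one less,
    so that the pairs can be removed one after the other.

    Let c be a chain representing sigma. A face of the link is the orbit of a
    chain b that contains c. Call a set squarefree when the elements that it has
    outside T carry distinct letters; T is squarefree and, by hypothesis, S is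
    not. Hence among the members of b and S there is a least one, w, that is not
    squarefree. Let v be a transversal of w over T: it consists of T and, for
    each letter occurring in w outside T, one such occurrence; take it nested
    with every member of b. Such a v exists: extend the largest squarefree
    member of b or T to a maximal squarefree subset of w. The face is matched
    with the one obtained by adding v to b, or removing v if it is there.

    - This is well defined on orbits: two choices of v are exchanged by a
      permutation that moves elements within rows and fixes all members of b
      and w (pivot_swap, pivot_uniq).
    - It is an involution: v is squarefree, so toggling it does not change w
      (pivot_toggle). It stays in the link because T < v < S and no member of c
      lies strictly between T and S (over_toggle).
    - It is acyclic. Suppose that v is not in b, and let b' be a larger chain,
      with data w' and v'. Then w' is contained in w. If b' is not matched
      downwards to a chain of the size of b, or if w' is smaller than w, then
      the pair of b' is removed earlier when pairs are ordered by decreasing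
      size of the chain without v, then by increasing size of w. Otherwise
      w' = w, and b' is b with a transversal of w added, that is, the mate of b
      (height_link_lt).

    The last pair consists of the empty face and a vertex. The passage from
    such a matching to collapses is matching_collapsible. *)

Set Implicit Arguments.
Unset Strict Implicit.
Unset Printing Implicit Defensive.

(** * Collapsing along an acyclic matching *)

Section Matching.

Variables (F : finType) (le : rel F) (e : F) (K : {set F}).
Hypothesis le_trans : {in K & &, transitive le}.
Hypothesis le_anti : {in K &, antisymmetric le}.
Hypothesis eK : e \in K.
Hypothesis le_e : {in K, forall t, le e t}.

Definition subcomplex (L : {set F}) : Prop :=
  L \subset K /\ {in L & K, forall s t, le t s -> t \in L}.

(** The faces below r all lie in L, so a collapse does not change dimensions. *)
Lemma dim_subcomplex L r :
  subcomplex L -> r \in L -> dim le e L r = dim le e K r.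
Proof.
case=> /subsetP LK down rL; rewrite /dim; congr _.-1.
apply: eq_card => v; rewrite !inE andbC [RHS]andbC.
case le_vr: (le v r) => //=; rewrite /is_vertex.
have -> : (v \in L) = (v \in K).
  by apply/idP/idP => [/LK //|vK]; apply: down le_vr.
case vK: (v \in K) => //=; case: (v != e) => //=.
have vL : v \in L by apply: down le_vr.
apply/forall_inP/forall_inP => min t.
  move=> tK; apply/implyP => tv; have tL : t \in L.
    by case/andP: tv => _ ?; apply: (down v).
  by move/implyP: (min t tL); apply.
by move=> /LK; apply: min.
Qed.

(** The height orders the pairs {t, mu t} for removal, highest first: a face
    that properly contains the lower member of a pair, and is not its mate,
    belongs to a higher pair. *)
Variables (mu : F -> F) (h : F -> nat).
Hypothesis mu_in : {in K, forall t, mu t \in K}.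
Hypothesis muK : {in K, involutive mu}.
Hypothesis mu_neq : {in K, forall t, mu t != t}.
Hypothesis mu_comparable : {in K, forall t, le t (mu t) || le (mu t) t}.
Hypothesis mu_dim : {in K, forall t, t != e -> le t (mu t) ->
  dim le e K (mu t) = (dim le e K t).+1}.
Hypothesis height_mu : {in K, forall t, h (mu t) = h t}.
Hypothesis height_lt : {in K &, forall t s, le t (mu t) ->
  properly_contained le t s -> s != mu t -> h t < h s}.

Lemma height_e : {in K, forall t, t != e -> t != mu e -> h e < h t}.
Proof.
move=> t tK te tme; apply: height_lt => //; first by apply: le_e; apply: mu_in.
by rewrite /properly_contained eq_sym te le_e.
Qed.

Lemma mu_eq t s : t \in K -> s \in K -> mu t = mu s -> t = s.
Proof. by move=> tK sK mts; rewrite -(muK tK) mts muK. Qed.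

(** A face strictly between e and mu e would belong to a pair whose lower
    member is contained in mu e, hence to a pair lower than that of e; but the
    latter is the lowest, since e is contained in every face. *)
Lemma mu_e_vertex : is_vertex le e K (mu e).
Proof.
rewrite /is_vertex mu_in // mu_neq //=.
apply/forall_inP => t tK; apply/implyP => /andP[t_me le_t].
apply/eqP/eqP; apply/negPn/negP => te.
have lt_et := height_e tK te t_me.
case/orP: (mu_comparable tK) => le_mu.
  have: h t < h (mu e).
    apply: height_lt => //; rewrite ?mu_in // ?/properly_contained ?t_me //.
    by apply: contraNneq te => /esym/mu_eq ->.
  by rewrite height_mu // ltnNge ltnW.
have: h (mu t) < h (mu e).
  apply: height_lt; rewrite ?mu_in // ?muK // 1?eq_sym //.
  rewrite /properly_contained (le_trans tK (mu_in tK) (mu_in eK) le_mu le_t) andbT.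
  by apply: contraNneq te => /mu_eq ->.
by rewrite !height_mu // ltnNge ltnW.
Qed.

(** The highest remaining pair other than {e, mu e} is always an elementary
    collapse, since whatever else contains its lower member has been removed. *)
Lemma collapse_matched_subcomplex L :
  subcomplex L -> e \in L -> {in L, forall t, mu t \in L} ->
  connect (elementary_collapse le e) L [set e; mu e].
Proof.
elim: {L}_.+1 {-2}L (ltnSn #|L|) => // N IH L ltN subL eL muL.
have [/subsetP LK down] := subL.
pose low t := [&& t \in L, t != e & le t (mu t)].
case: (pickP low) => [t0 t0P|noP]; last first.
  suff -> : L = [set e; mu e] by apply: connect0.
  apply/setP => t; rewrite !inE; apply/idP/idP; last first.
    by case/orP => /eqP-> //; apply: muL.
  move=> tL; have tK := LK _ tL; case: (eqVneq t e) => //= te.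
  case/orP: (mu_comparable tK) => le_mu; first by have := noP t; rewrite /low tL te le_mu.
  have := noP (mu t); rewrite /low muL // muK // le_mu andbT /= => /negbFE/eqP <-.
  by rewrite muK.
(* t is the lower member of a highest pair. *)
case: (arg_maxnP h t0P) => t /and3P[tL te le_t] tmax.
have tK := LK _ tL.
have only s : s \in L -> properly_contained le t s -> s = mu t.
  move=> sL ts; have sK := LK _ sL; apply/eqP/negPn/negP => s_mu.
  have lt_ts := height_lt tK sK le_t ts s_mu.
  have se : s != e.
    apply: contraTneq lt_ts => ->; rewrite -leqNgt.
    case: (eqVneq t (mu e)) => [->|t_me]; first by rewrite height_mu.
    exact/ltnW/height_e.
  case/orP: (mu_comparable sK) => le_s.
    by move: (tmax s); rewrite /low sL se le_s /= => /(_ isT) /=; rewrite leqNgt lt_ts.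
  case: (eqVneq (mu s) e) => [mse|mse].
    have s_me : s = mu e by rewrite -mse muK.
    have t_me : t != mu e by rewrite -s_me; case/andP: ts.
    by have := height_e tK te t_me; rewrite ltnNge => /negP[]; rewrite -(height_mu eK) -s_me ltnW.
  move: (tmax (mu s)); rewrite /low muL // mse muK // le_s height_mu // => /(_ isT) /=.
  by rewrite leqNgt lt_ts.
have t_mu : properly_contained le t (mu t).
  by rewrite /properly_contained eq_sym mu_neq.
have mtL := muL _ tL.
have me : mu t != e.
  apply: contraNneq (mu_neq tK) => mte; rewrite mte; apply/eqP/le_anti => //.
  by rewrite le_e // -mte le_t.
apply: (@connect_trans _ _ (L :\: [set t; mu t])).
  apply/connect1/existsP; exists t; apply/existsP; exists (mu t).
  rewrite tL mtL te me t_mu !dim_subcomplex // mu_dim // !eqxx /= andbT.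
  by apply/forall_inP => s sL; apply/implyP => /only->.
apply: IH.
- rewrite -ltnS; apply: leq_trans ltN; rewrite ltnS; apply: proper_card.
  rewrite properE subsetDl /=; apply/subsetPn; exists t => //.
  by rewrite !inE eqxx.
- split; first by apply/subsetP => s /setDP[/LK].
  move=> s r /setDP[sL]; rewrite !inE negb_or => /andP[st smt] rK le_rs.
  rewrite (down s) // andbT; apply/norP; split; apply/negP => /eqP rE.
    case/negP: smt; apply/eqP/only => //.
    by rewrite /properly_contained eq_sym st -rE /=.
  case/negP: smt; apply/eqP/only => //.
  rewrite /properly_contained eq_sym st.
  rewrite rE in le_rs; exact: le_trans (mu_in tK) tK (LK _ sL) le_t le_rs.
- by rewrite !inE eL andbT negb_or eq_sym te eq_sym.
- move=> s /setDP[sL]; rewrite !inE negb_or => /andP[st smt].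
  have sK := LK _ sL; rewrite muL // andbT negb_or; apply/andP; split.
    by apply: contraNneq smt => <-; rewrite muK.
  by apply: contraNneq st => /mu_eq ->.
Qed.

Theorem matching_collapsible : collapsible le e K.
Proof.
exists (mu e); first exact: mu_e_vertex.
by apply: collapse_matched_subcomplex => //; split.
Qed.

End Matching.

(** * Exchanging two transversals *)

Section Letters.

Variables (X L : finType) (letter : X -> L).

(** The permutation is the involution that exchanges the elements of A and B
    carrying the same letter. *)
Lemma transversal_swap (A B : {set X}) :
    {in A &, injective letter} -> {in B &, injective letter} ->
    letter @: A = letter @: B ->
  exists g : {perm X}, [/\ forall x, letter (g x) = letter x,
    forall x, x \in A -> g x \in B, forall x, x \in B -> g x \in A,
    forall x, x \notin A :|: B -> g x = x & forall x, x \in A :&: B -> g x = x].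
Proof.
move=> injA injB eAB.
pose tr (C : {set X}) x := odflt x [pick y in C | letter y == letter x].
have trP (C : {set X}) x : letter x \in letter @: C ->
    tr C x \in C /\ letter (tr C x) = letter x.
  case/imsetP => y yC xy; rewrite /tr; case: pickP => [z /andP[zC /eqP] //|].
  by move/(_ y); rewrite yC xy eqxx.
have trB x : x \in A -> tr B x \in B /\ letter (tr B x) = letter x.
  by move=> xA; apply: trP; rewrite -eAB imset_f.
have trA x : x \in B -> tr A x \in A /\ letter (tr A x) = letter x.
  by move=> xB; apply: trP; rewrite eAB imset_f.
pose f x := if x \in A then tr B x else if x \in B then tr A x else x.
have f_letter x : letter (f x) = letter x.
  by rewrite /f; case: ifP => [/trB[]|_] //; case: ifP => [/trA[]|].
have fAB x : x \in A -> f x \in B by rewrite /f => xA; rewrite xA; case: (trB x).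
have fI x : x \in A :&: B -> f x = x.
  by case/setIP => xA xB; apply: injB; rewrite ?f_letter ?fAB.
have fBA x : x \in B -> f x \in A.
  move=> xB; case xA: (x \in A); first by rewrite fI ?xA // inE xA.
  by rewrite /f xA xB; case: (trA x).
have f_out x : x \notin A :|: B -> f x = x.
  by rewrite /f inE negb_or => /andP[/negbTE-> /negbTE->].
have fK : involutive f.
  move=> x; case xA: (x \in A).
    by apply: injA; rewrite ?f_letter // fBA ?fAB.
  case xB: (x \in B); first by apply: injB; rewrite ?f_letter // fAB ?fBA.
  by rewrite !f_out // inE xA xB.
exists (perm (inv_inj fK)); split=> x; rewrite permE //; auto.
Qed.

End Letters.

(** * Permutations acting on chains of sets *)

Local Notation actS := ('P^*)%act.
Local Notation actC := ('P^*^*)%act.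

Section Chains.

Variable n : nat.
Implicit Types (u v w x T S : {set 'I_n}) (b c : {set {set 'I_n}}) (g : 'S_n).

Lemma mem_actS u g i : (g i \in actS u g) = (i \in u).
Proof. by rewrite -[RHS](mem_imset _ _ (@perm_inj _ g)) /= setactE. Qed.

Lemma mem_actC b g u : (actS u g \in actC b g) = (u \in b).
Proof. by rewrite /= setactE mem_imset //; apply: act_inj. Qed.

Lemma actS_sub u v g : (actS u g \subset actS v g) = (u \subset v).
Proof.
apply/subsetP/subsetP => [uv i iu|uv].
  by rewrite -(mem_actS _ g) uv ?mem_actS.
by rewrite /= setactE => _ /imsetP[i iu ->]; rewrite mem_actS uv.
Qed.

Lemma actSP u g j : reflect (exists2 i, i \in u & j = g i) (j \in actS u g).
Proof. by rewrite /= setactE; apply: imsetP. Qed.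

Lemma actCP b g v : reflect (exists2 u, u \in b & v = actS u g) (v \in actC b g).
Proof. by rewrite /= setactE; apply: imsetP. Qed.

Lemma actS_fix u g : (forall i, i \in u -> g i \in u) -> actS u g = u.
Proof.
move=> gu; apply/eqP; rewrite eqEcard card_setact leqnn andbT.
by apply/subsetP => _ /actSP[i iu ->]; apply: gu.
Qed.

Lemma actC_fix b g : (forall u, u \in b -> actS u g = u) -> actC b g = b.
Proof.
move=> gb; apply/eqP; rewrite eqEcard card_setact leqnn andbT.
by apply/subsetP => _ /actCP[u ub ->]; rewrite gb.
Qed.

Lemma actC_sub b b' g : (actC b g \subset actC b' g) = (b \subset b').
Proof.
apply/subsetP/subsetP => [bb u ub|bb].
  by rewrite -(mem_actC _ g) bb ?mem_actC.
by move=> _ /actCP[i iu ->]; rewrite mem_actC bb.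
Qed.

Definition nested u v := (u \subset v) || (v \subset u).

Lemma DeltaP b :
  reflect [/\ set0 \notin b, setT \notin b & {in b &, forall u v, nested u v}]
          (b \in Delta n).
Proof.
rewrite inE; apply: (iffP and3P) => -[b0 bT bc]; split=> //.
  by move=> u v ub vb; have /forall_inP/(_ _ vb) := forall_inP bc _ ub.
by apply/forall_inP => u ub; apply/forall_inP => v vb; apply: bc.
Qed.

Lemma Delta_sub b b' : b \subset b' -> b' \in Delta n -> b \in Delta n.
Proof.
move/subsetP => bb /DeltaP[b0 bT bc]; apply/DeltaP; split.
- by apply: contra b0; apply: bb.
- by apply: contra bT; apply: bb.
- by move=> u v /bb ? /bb ?; apply: bc.
Qed.

Lemma Delta_act b g : b \in Delta n -> actC b g \in Delta n.
Proof.
have act0 : actS set0 g = set0 by apply: actS_fix => i; rewrite inE.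
have actT : actS setT g = setT by apply: actS_fix => i; rewrite inE.
case/DeltaP => b0 bT bc; apply/DeltaP; split.
- by rewrite -act0 mem_actC.
- by rewrite -actT mem_actC.
- move=> _ _ /actCP[u ub ->] /actCP[v vb ->]; rewrite /nested !actS_sub; exact: bc.
Qed.

Lemma nested_card u v : nested u v -> #|u| <= #|v| -> u \subset v.
Proof.
case/orP => // vu le_uv; suff -> : v = u by [].
by apply/eqP; rewrite eqEcard vu.
Qed.

Lemma nested_eq u v : nested u v -> #|u| = #|v| -> u = v.
Proof.
move=> uv e; apply/eqP; rewrite eqEcard e leqnn andbT.
by apply: nested_card; rewrite ?e.
Qed.

(** A permutation preserves cardinalities, and a chain has at most one member of
    each cardinality. *)
Lemma act_fix_chain c b b' g : c \subset b -> c \subset b' -> b' \in Delta n ->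
  actC b g \subset b' -> {in c, forall u, actS u g = u}.
Proof.
move=> /subsetP cb /subsetP cb' /DeltaP[_ _ b'c] /subsetP gb u uc.
apply: nested_eq; last by rewrite card_setact.
by apply: b'c; [apply: gb; rewrite mem_actC cb | apply: cb'].
Qed.

Lemma act_fix_bounded c g : {in c, forall u, actS u g = u} ->
  {in bounded_chain c, forall u, actS u g = u}.
Proof.
move=> gc u; rewrite /bounded_chain in_setU !inE -orbA => /or3P[/eqP->|/eqP->|/gc //].
  by apply: actS_fix => i; rewrite inE.
by apply: actS_fix => i; rewrite inE.
Qed.

End Chains.

(** * The link of a face of the quotient *)

Section Link.

Local Open Scope group_scope.

Variables (n : nat) (G : {group 'S_n}).
Implicit Types (u v w x T S : {set 'I_n}) (b : {set {set 'I_n}}) (g : 'S_n).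

Local Notation orb := (orbit ('P^*^*) G).

Variable c : {set {set 'I_n}}.
Hypothesis c_chain : c \in Delta n.

Definition over b := (b \in Delta n) && (c \subset b).

Lemma over_c : over c.
Proof. by rewrite /over c_chain subxx. Qed.

Lemma over_sub b b' : c \subset b -> b \subset b' -> over b' -> over b.
Proof. by rewrite /over => -> bb /andP[/(Delta_sub bb)->]. Qed.

Lemma mem_orb b b' : reflect (exists2 g, g \in G & b' = actC b g) (b' \in orb b).
Proof. by apply: (iffP orbitP) => -[g gG e]; exists g. Qed.

Lemma orb_act b g : g \in G -> orb (actC b g) = orb b.
Proof. by move=> gG; apply: orbit_act. Qed.

Lemma orb_eqP b b' : reflect (exists2 g, g \in G & b' = actC b g) (orb b == orb b').
Proof. by apply: (iffP eqP) => [/esym/orbit_eqP/mem_orb | [g gG ->]]; rewrite ?orb_act. Qed.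

Lemma orb_le_down b b' : over b -> over b' -> orbit_le (orb b) (orb b') ->
  exists2 g, g \in G & over (actC b g) /\ actC b g \subset b'.
Proof.
case/andP=> bD cb /andP[b'D cb'] /exists_inP[_ /mem_orb[g gG ->]].
case/exists_inP => [_ /mem_orb[g' g'G ->]] sub.
have sub' : actC b (g * g'^-1) \subset b'.
  by rewrite -(actC_sub _ _ g') -actM mulgKV.
exists (g * g'^-1); first by rewrite groupM ?groupV.
split=> //; rewrite /over Delta_act //.
apply/subsetP => u uc; rewrite -(act_fix_chain cb cb' b'D sub' uc) mem_actC.
exact: (subsetP cb).
Qed.

Lemma orb_le b b' : b \subset b' -> orbit_le (orb b) (orb b').
Proof.
move=> bb; apply/exists_inP; exists b; first exact: orbit_refl.
by apply/exists_inP; exists b'; first exact: orbit_refl.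
Qed.

Lemma mem_link r : reflect (exists2 b, over b & r = orb b) (r \in link G (orb c)).
Proof.
rewrite inE; apply: (iffP andP) => [[/imsetP[b bD ->]]|[b /andP[bD cb] ->]].
  case/exists_inP => [_ /mem_orb[g gG ->]].
  case/exists_inP => [_ /mem_orb[g' g'G ->]] sub.
  exists (actC b (g' * g^-1)).
    by rewrite /over Delta_act //= -(actC_sub _ _ g) -actM mulgKV.
  by rewrite orb_act // groupM ?groupV.
by rewrite orb_le //; split=> //; apply: imset_f.
Qed.

Lemma link_orb b : over b -> orb b \in link G (orb c).
Proof. by move=> ob; apply/mem_link; exists b. Qed.

Lemma card_orb b b' : orb b = orb b' -> #|b| = #|b'|.
Proof. by move/eqP/orb_eqP => [g _ ->]; rewrite card_setact. Qed.

Lemma link_le_down r b' : over b' -> r \in link G (orb c) ->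
  orbit_le r (orb b') -> exists b, [/\ over b, r = orb b & b \subset b'].
Proof.
move=> ob' /mem_link[b ob ->] le_bb'.
have [g gG [ogb sub]] := orb_le_down ob ob' le_bb'.
by exists (actC b g); rewrite orb_act.
Qed.

Lemma link_le_up b r : over b -> r \in link G (orb c) ->
  orbit_le (orb b) r -> exists b', [/\ over b', r = orb b' & b \subset b'].
Proof.
move=> ob /mem_link[b' ob' ->] le_bb'.
have [g gG [_ sub]] := orb_le_down ob ob' le_bb'.
exists (actC b' g^-1); rewrite orb_act ?groupV //.
have sub' : b \subset actC b' g^-1 by rewrite -(actC_sub _ _ g) actKV.
have [[bD cb] [b'D cb']] := (andP ob, andP ob').
by rewrite /over Delta_act //= (subset_trans cb sub').
Qed.

Lemma link_le_trans : {in link G (orb c) & &, transitive (@orbit_le n)}.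
Proof.
move=> y x z yK xK /mem_link[b ob ->] xy yb.
have [b1 [ob1 e1 sub1]] := link_le_down ob yK yb; subst y.
have [b2 [ob2 e2 sub2]] := link_le_down ob1 xK xy; subst x.
exact/orb_le/(subset_trans sub2).
Qed.

Lemma link_le_anti : {in link G (orb c) &, antisymmetric (@orbit_le n)}.
Proof.
move=> x y xK /mem_link[b ob ->] /andP[xy yx].
have [b1 [ob1 e1 sub1]] := link_le_down ob xK xy; subst x.
have [b2 [ob2 e2 sub2]] := link_le_down ob1 (link_orb ob) yx.
suff -> : b1 = b by [].
by apply/eqP; rewrite eqEcard sub1 (card_orb e2) subset_leq_card.
Qed.

Lemma link_le_min : {in link G (orb c), forall r, orbit_le (orb c) r}.
Proof. by move=> _ /mem_link[b /andP[_ cb] ->]; apply: orb_le. Qed.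

Local Notation vertex := (is_vertex (@orbit_le n) (orb c) (link G (orb c))).

Lemma vertexP b r : over b ->
  reflect (exists2 u, u \in b :\: c & r = orb (u |: c)) (vertex r && orbit_le r (orb b)).
Proof.
move=> ob; apply: (iffP andP) => [[/and3P[rK re /forall_inP rmin] rb]|[u]].
  have [b1 [ob1 e1 sub1]] := link_le_down ob rK rb; subst r.
  have [b1D cb1] := andP ob1.
  have /set0Pn[u ub1] : b1 :\: c != set0.
    by rewrite setD_eq0; apply: contraNN re => b1c; rewrite [b1](_ : _ = c) //;
      apply/eqP; rewrite eqEsubset b1c.
  have [ub uc] := setDP ub1.
  have sub : u |: c \subset b1 by rewrite subUset sub1set ub.
  exists u; first by rewrite inE uc (subsetP sub1).
  have ou : over (u |: c) by apply: over_sub sub ob1; apply: subsetUr.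
  apply/esym/eqP/negPn/negP => ne.
  have /implyP := rmin _ (link_orb ou).
  rewrite /properly_contained ne orb_le // => /(_ isT) /eqP /card_orb /eqP.
  by rewrite cardsU1 uc -{2}[#|c|]add0n eqn_add2r.
case/setDP => ub uc ->.
have sub : u |: c \subset b by rewrite subUset sub1set ub; case/andP: ob.
have ou : over (u |: c) by apply: over_sub sub ob; apply: subsetUr.
split; last exact: orb_le.
apply/and3P; split; first exact: link_orb.
  apply/eqP => /card_orb /eqP.
  by rewrite cardsU1 uc -{2}[#|c|]add0n eqn_add2r.
apply/forall_inP => t tK; apply/implyP => /andP[ne le_t].
have [b1 [ob1 e1 sub1]] := link_le_down ou tK le_t; subst t.
have [b1D cb1] := andP ob1; apply/eqP; congr orb; apply/eqP.
rewrite eq_sym eqEcard cb1 -ltnS.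
have -> : #|c|.+1 = #|u |: c| by rewrite cardsU1 uc.
rewrite ltn_neqAle subset_leq_card // andbT.
by apply: contraNneq ne => eb; rewrite [b1](_ : _ = u |: c) //; apply/eqP; rewrite eqEcard sub1 eb /=.
Qed.

(** The vertices of the face of b correspond to the members of b outside c:
    these have different cardinalities, hence lie in different orbits. *)
Lemma dim_link b : over b ->
  dim (@orbit_le n) (orb c) (link G (orb c)) (orb b) = (#|b| - #|c|).-1.
Proof.
move=> ob; have [bD cb] := andP ob; rewrite /dim; congr _.-1.
have -> : #|b| - #|c| = #|b :\: c| by rewrite cardsD (setIidPr cb).
rewrite -(card_in_imset (f := fun u => orb (u |: c))).
  apply: eq_card => r; rewrite inE; apply/(vertexP _ ob)/imsetP => -[u]; by exists u.
move=> u u' /setDP[ub uc] /setDP[u'b u'c] /eqP /orb_eqP[g gG e].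
have sub x : x \in b -> x |: c \subset b by move=> xb; rewrite subUset sub1set xb.
have fixc : {in c, forall x, actS x g = x}.
  apply: (act_fix_chain (b := u |: c) (b' := u' |: c)); rewrite -?e ?subsetUr //.
  exact: Delta_sub (sub _ u'b) bD.
have gu : actS u g \in u' |: c by rewrite e mem_actC setU11.
have {gu} gu : actS u g = u'.
  case/setU1P: gu => // guc; case/negP: uc.
  by rewrite -(mem_actC _ g) actC_fix.
have [_ _ bc] := DeltaP _ bD.
by apply: nested_eq; [apply: bc | rewrite -gu card_setact].
Qed.

Lemma sub_bounded b : {subset b <= bounded_chain b}.
Proof. by move=> u ub; rewrite inE ub orbT. Qed.

Lemma bounded_chainS b : over b -> {subset bounded_chain c <= bounded_chain b}.
Proof. by case/andP => _ cb; apply/subsetP; rewrite setUS. Qed.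

Lemma over_nested b : over b ->
  {in bounded_chain b &, forall u v, nested u v}.
Proof.
case/andP => /DeltaP[_ _ bc] _ u v.
rewrite /bounded_chain !in_setU !inE -!orbA /nested.
case/or3P => [/eqP->|/eqP->|ub]; rewrite ?sub0set ?subsetT ?orbT //.
case/or3P => [/eqP->|/eqP->|vb]; rewrite ?sub0set ?subsetT ?orbT //.
exact: bc.
Qed.

End Link.

(** * The matching on the link *)

Section Pivot.

Local Open Scope group_scope.

(** The matching rests on two properties of the wreath product: elements with
    equal letters keep equal letters, so that being squarefree is invariant, and
    permutations that keep all letters belong to the group, so that transversals
    can be exchanged. *)
Variables (n : nat) (L : finType) (letter : 'I_n -> L) (G : {group 'S_n}).
Hypothesis letter_equiv : forall g x y, g \in G ->
  letter x = letter y -> letter (g x) = letter (g y).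
Hypothesis letter_stab : forall g : 'S_n,
  (forall x, letter (g x) = letter x) -> g \in G.

Implicit Types (u v w x : {set 'I_n}) (b : {set {set 'I_n}}) (g : 'S_n).

Local Notation orb := (orbit ('P^*^*) G).

Variable c : {set {set 'I_n}}.
Hypothesis c_chain : c \in Delta n.

Local Notation over := (over c).

Variables T S : {set 'I_n}.
Hypothesis T_in : T \in bounded_chain c.
Hypothesis S_in : S \in bounded_chain c.
Hypothesis TS_consecutive :
  forall U, U \in bounded_chain c -> ~~ ((T \proper U) && (U \proper S)).

Definition squarefree u := #|letter @: (u :\: T)| == #|u :\: T|.

Lemma squarefreeP u : reflect {in u :\: T &, injective letter} (squarefree u).
Proof. exact: imset_injP. Qed.

Hypothesis S_repeats : ~~ squarefree S.

Lemma squarefree_sub u v : u \subset v -> squarefree v -> squarefree u.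
Proof.
move=> uv /squarefreeP injv; apply/squarefreeP => i j iu ju; apply: injv.
  exact: (subsetP (setSD T uv)).
exact: (subsetP (setSD T uv)).
Qed.

Lemma squarefree_T : squarefree T.
Proof. by rewrite /squarefree setDv imset0 !cards0. Qed.

(** The set w is the least member of b or S that repeats a letter outside T, and
    v is a transversal of w over T compatible with b. *)
Definition pivot b w v : bool :=
  [&& [&& over b, w \in S |: b, ~~ squarefree w & [forall u in S |: b, squarefree u || (w \subset u)]],
      T \subset v, v \subset w, squarefree v &
      (letter @: (v :\: T) == letter @: (w :\: T)) && [forall u in b, nested u v]].

Record pivot_spec b w v : Prop := PivotSpec {
  pivot_over : over b;
  pivot_w_in : w \in S |: b;
  pivot_w_repeats : ~~ squarefree w;
  pivot_w_min : {in S |: b, forall u, ~~ squarefree u -> w \subset u};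
  pivot_T : T \subset v;
  pivot_w : v \subset w;
  pivot_squarefree : squarefree v;
  pivot_letters : letter @: (v :\: T) = letter @: (w :\: T);
  pivot_nested : {in b, forall u, nested u v} }.

Lemma pivotP b w v : reflect (pivot_spec b w v) (pivot b w v).
Proof.
apply: (iffP and5P) => [[/and4P[ob wb w_r /forall_inP wmin] Tv vw vs /andP[/eqP vl /forall_inP vb]]|].
  by split=> // u /wmin /orP[->|].
case=> ob wb w_r wmin Tv vw vs vl vb; split=> //.
  apply/and4P; split=> //; apply/forall_inP => u ub.
  by case: (boolP (squarefree u)) => //= /wmin->.
by rewrite vl eqxx; apply/forall_inP.
Qed.

(** A squarefree subset of w that is maximal meets every letter that w has
    outside T. Starting from the largest squarefree member u of b or T makes it
    contain all squarefree members of b; the others contain w. *)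
Lemma pivot_exists b : over b -> exists w v, pivot b w v.
Proof.
move=> ob; have compb := over_nested ob.
have Tb := bounded_chainS ob T_in; have Sb := bounded_chainS ob S_in.
have Sbb u : u \in S |: b -> u \in bounded_chain b.
  by case/setU1P => [-> //|]; apply: sub_bounded.
have Tbb u : u \in T |: b -> u \in bounded_chain b.
  by case/setU1P => [-> //|]; apply: sub_bounded.
have wP0 : (S \in S |: b) && ~~ squarefree S by rewrite setU11.
case: (arg_minnP (P := fun u => (u \in S |: b) && ~~ squarefree u) (fun u : {set 'I_n} => #|u|) wP0) => w /andP[wb w_r] wmin.
have uP0 : (T \in T |: b) && squarefree T by rewrite setU11 squarefree_T.
case: (arg_maxnP (P := fun u => (u \in T |: b) && squarefree u) (fun u : {set 'I_n} => #|u|) uP0) => u /andP[ub u_s] umax.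
have Tu : T \subset u.
  by apply: nested_card; [apply: compb => //; apply: Tbb | apply: umax].
have uw : u \subset w.
  have := compb u w (Tbb _ ub) (Sbb _ wb); case/orP => // wu.
  by rewrite (squarefree_sub wu u_s) in w_r.
have [v /maxsetP[/andP[vw v_s] vmax] uv] :
    {v | maxset (fun v : {set 'I_n} => (v \subset w) && squarefree v) v & u \subset v}.
  by apply: maxset_exists; rewrite uw.
have Tv := subset_trans Tu uv.
exists w, v; apply/pivotP; split=> //.
- move=> x xb x_r; apply: nested_card; first by apply: compb; apply: Sbb.
  by apply: wmin; rewrite xb.
- apply/eqP; rewrite eqEsubset imsetS ?setSD //=.
  apply/subsetP => _ /imsetP[y /setDP[yw yT] ->].
  apply/negPn/negP => new.
  have yv : y \notin v.
    by apply: contra new => yv; apply: imset_f; rewrite inE yT.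
  case/negP: yv; rewrite -(vmax (y |: v)) ?setU11 ?subsetUr //.
  rewrite subUset sub1set yw vw /=; apply/squarefreeP => i j.
  have cases k : k \in (y |: v) :\: T -> k = y \/ k \in v :\: T.
    by rewrite !inE => /andP[-> /orP[/eqP->|->]]; [left|right].
  move=> /cases[->|iv] /cases[->|jv] // eij.
  + by case/negP: new; rewrite eij imset_f.
  + by case/negP: new; rewrite -eij imset_f.
  + exact: (squarefreeP _ v_s).
- move=> x xb; case: (boolP (squarefree x)) => x_s; apply/orP; [left|right].
    apply: subset_trans uv; apply: nested_card.
      by apply: compb; [apply: sub_bounded | apply: Tbb].
    by apply: umax; rewrite in_setU1 xb orbT.
  apply: (subset_trans vw); apply: nested_card.
    by apply: compb; [apply: Sbb | apply: sub_bounded].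
  by apply: wmin; rewrite in_setU1 xb orbT.
Qed.

Lemma pivot_w_uniq b w v w' v' : pivot b w v -> pivot b w' v' -> w = w'.
Proof.
move=> /pivotP p /pivotP p'; apply/eqP; rewrite eqEsubset.
rewrite (pivot_w_min p) ?(pivot_w_in p') ?(pivot_w_repeats p') //.
by rewrite (pivot_w_min p') ?(pivot_w_in p) ?(pivot_w_repeats p).
Qed.

Lemma pivot_card b w v : pivot b w v -> #|v| = #|T| + #|letter @: (w :\: T)|.
Proof.
move=> /pivotP p; rewrite -(pivot_letters p) (eqP (pivot_squarefree p)).
by rewrite -(cardsID T v) (setIidPr (pivot_T p)).
Qed.

(** A member of b lies below both transversals or above both, and the exchange
    of the two only moves elements between them, so it fixes that member. *)
Lemma pivot_swap b w v v' : pivot b w v -> pivot b w v' ->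
  exists g, [/\ g \in G, actC b g = b, actS w g = w & actS v g = v'].
Proof.
move=> pv pv'; have [p p'] := (pivotP _ _ _ pv, pivotP _ _ _ pv').
have el : letter @: (v :\: T) = letter @: (v' :\: T).
  by rewrite (pivot_letters p) (pivot_letters p').
have [g [gl gv gv' gout gin]] :=
  transversal_swap (squarefreeP _ (pivot_squarefree p)) (squarefreeP _ (pivot_squarefree p')) el.
have ev : #|v'| = #|v| by rewrite (pivot_card pv) (pivot_card pv').
have gT i : i \in T -> g i = i by move=> iT; apply: gout; rewrite !inE iT.
have above u : v \subset u -> v' \subset u -> actS u g = u.
  move=> /subsetP vu /subsetP v'u; apply: actS_fix => i iu.
  case: (boolP (i \in v :\: T)) => [/gv/setDP[/v'u]//|iv].
  case: (boolP (i \in v' :\: T)) => [/gv'/setDP[/vu]//|iv'].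
  by rewrite gout // in_setU negb_or iv.
have below u : u \subset v -> u \subset v' -> actS u g = u.
  move=> /subsetP uv /subsetP uv'; apply: actS_fix => i iu.
  case: (boolP (i \in T)) => [/gT->//|iT].
  by rewrite gin // !inE iT uv ?uv'.
have gvv' : actS v g = v'.
  apply/eqP; rewrite eqEcard card_setact; apply/andP; split.
    apply/subsetP => _ /actSP[i iv ->]; case: (boolP (i \in T)) => iT.
      by rewrite gT // (subsetP (pivot_T p')).
    by have /setDP[] : g i \in v' :\: T by apply: gv; rewrite inE iT.
  by rewrite ev leqnn.
exists g; split=> //; first exact: letter_stab.
  apply: actC_fix => u ub.
  case/orP: (pivot_nested p ub) => uv; case/orP: (pivot_nested p' ub) => uv'.
  - exact: below.
  - have evv' : v' = v by apply/eqP; rewrite eqEcard ev leqnn (subset_trans uv').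
    by apply: below; rewrite ?evv'.
  - have evv' : v = v' by apply/eqP; rewrite eqEcard ev leqnn (subset_trans uv).
    by apply: below; rewrite ?evv'.
  - exact: above.
by apply: above; [apply: pivot_w p | apply: pivot_w p'].
Qed.

(** Since g maps a chain containing c to another one, it fixes T and S. *)
Lemma pivot_act b w v g : pivot b w v -> g \in G -> over (actC b g) ->
  pivot (actC b g) (actS w g) (actS v g).
Proof.
move=> /pivotP p gG ob'; have [_ cb] := andP (pivot_over p); have [b'D cb'] := andP ob'.
have fixc := act_fix_bounded (act_fix_chain cb cb' b'D (subxx _)).
have gT : actS T g = T by apply: fixc.
have gS : actS S g = S by apply: fixc.
have letter_inj i j : letter (g i) = letter (g j) -> letter i = letter j.
  move=> eij; rewrite -(permK g i) -(permK g j).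
  by apply: letter_equiv => //; rewrite groupV.
have setDT u : actS u g :\: T = actS (u :\: T) g.
  apply/setP => j; rewrite -(permKV g j) mem_actS !inE mem_actS.
  by rewrite -{1}gT mem_actS.
have gsquarefree u : squarefree u -> squarefree (actS u g).
  move=> /squarefreeP inju; apply/squarefreeP; rewrite setDT.
  by move=> _ _ /actSP[i iu ->] /actSP[j ju ->] /letter_inj/inju->.
have gsquarefreeV u : squarefree (actS u g) -> squarefree u.
  move=> /squarefreeP; rewrite setDT => inju; apply/squarefreeP => i j iu ju eij.
  by apply: (@perm_inj _ g); apply: inju; rewrite ?mem_actS //; apply: letter_equiv.
have memS u : (actS u g \in S |: actC b g) = (u \in S |: b).
  by rewrite !in_setU1 mem_actC -{1}gS (inj_eq (act_inj _ g)).
have memSP u : u \in S |: actC b g -> exists2 u', u' \in S |: b & u = actS u' g.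
  case/setU1P => [->|/actCP[u' u'b ->]]; first by exists S; rewrite ?setU11.
  by exists u' => //; rewrite in_setU1 u'b orbT.
apply/pivotP; split=> //.
- by rewrite memS (pivot_w_in p).
- by apply: contra (pivot_w_repeats p); apply: gsquarefreeV.
- move=> _ /memSP[u ub ->] u_r; rewrite actS_sub; apply: (pivot_w_min p) => //.
  by apply: contra u_r; apply: gsquarefree.
- by rewrite -gT actS_sub (pivot_T p).
- by rewrite actS_sub (pivot_w p).
- by apply: gsquarefree; apply: pivot_squarefree p.
- have half u u' : letter @: (u :\: T) = letter @: (u' :\: T) ->
      letter @: (actS u g :\: T) \subset letter @: (actS u' g :\: T).
    move=> el; rewrite !setDT; apply/subsetP => _ /imsetP[_ /actSP[i iu ->] ->].
    have : letter i \in letter @: (u' :\: T) by rewrite -el imset_f.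
    case/imsetP => j ju' /(letter_equiv gG) ->.
    by apply: imset_f; rewrite mem_actS.
  by apply/eqP; rewrite eqEsubset !half // (pivot_letters p).
- move=> _ /actCP[u ub ->]; rewrite /nested !actS_sub; exact: (pivot_nested p).
Qed.

Lemma pivot_uniq b w v b' w' v' :
    pivot b w v -> pivot b' w' v' -> orb b = orb b' ->
  exists g, [/\ g \in G, actC b g = b', actS w g = w' & actS v g = v'].
Proof.
move=> p p' /eqP/orb_eqP[g gG eb'].
have pg : pivot b' (actS w g) (actS v g).
  by rewrite eb'; apply: pivot_act => //; rewrite -eb'; case/pivotP: p'.
have ew := pivot_w_uniq pg p'; rewrite ew in pg.
have [g' [g'G eb ew' ev]] := pivot_swap pg p'.
by exists (g * g'); rewrite groupM // !actM -eb' ew ew'.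
Qed.

Definition toggle b v := if v \in b then b :\ v else v |: b.

Lemma pivot_proper b w v : pivot b w v -> (T \proper v) && (v \proper S).
Proof.
move=> /pivotP p; rewrite !properEneq (pivot_T p) !andbT /=.
have wS : w \subset S by apply: (pivot_w_min p); rewrite ?setU11.
rewrite (subset_trans (pivot_w p) wS) andbT; apply/andP; split.
  apply: contraNneq (pivot_w_repeats p) => eT.
  have /eqP := pivot_letters p; rewrite -eT setDv imset0 eq_sym imset_eq0 => /eqP w0.
  by rewrite /squarefree w0 imset0 !cards0.
by apply: contraNneq S_repeats => <-; apply: pivot_squarefree p.
Qed.

Lemma pivot_notin_c b w v : pivot b w v -> v \notin c.
Proof.
move=> /pivot_proper pr; apply/negP => vc.
by have /negP := TS_consecutive (sub_bounded vc).
Qed.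

Lemma over_toggle b w v : pivot b w v -> over (toggle b v).
Proof.
move=> pv; have p := pivotP _ _ _ pv; have vc := pivot_notin_c pv.
have [bD cb] := andP (pivot_over p); rewrite /toggle; case: ifP => vb.
  by apply: over_sub (pivot_over p); rewrite ?subD1set // subsetD1 cb.
rewrite /over (subset_trans cb (subsetUr _ _)) andbT.
have [b0 bT bc] := DeltaP _ bD; have /andP[Tv vS] := pivot_proper pv.
have cv u : u \in b -> nested u v := pivot_nested p (x := u).
apply/DeltaP; split.
- rewrite in_setU1 negb_or b0 andbT eq_sym; apply: contraTneq Tv => ->.
  by rewrite properE sub0set andbF.
- rewrite in_setU1 negb_or bT andbT eq_sym; apply: contraTneq vS => ->.
  by rewrite properE subsetT andbF.
- move=> x y /setU1P[->|xb] /setU1P[->|yb].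
  + by rewrite /nested subxx.
  + by rewrite /nested orbC; apply: cv.
  + exact: cv.
  + exact: bc.
Qed.

Lemma pivot_toggle b w v : pivot b w v -> pivot (toggle b v) w v.
Proof.
move=> pv; have p := pivotP _ _ _ pv.
have wv : w != v by apply: contraNneq (pivot_w_repeats p) => ->; apply: pivot_squarefree p.
have mem u : u != v -> (u \in toggle b v) = (u \in b).
  by rewrite /toggle => /negbTE uv; case: ifP; rewrite !inE uv.
apply/pivotP; split; try by case: p.
- exact: over_toggle pv.
- by rewrite in_setU1 mem // -in_setU1 (pivot_w_in p).
- move=> u ub u_r; have uv : u != v by apply: contraNneq u_r => ->; apply: pivot_squarefree p.
  by apply: (pivot_w_min p) => //; move: ub; rewrite !in_setU1 mem.
- move=> u ub; case: (eqVneq u v) => [->|uv]; first by rewrite /nested subxx.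
  by apply: (pivot_nested p); rewrite -mem.
Qed.

Lemma toggleK b v : toggle (toggle b v) v = b.
Proof.
rewrite {2}/toggle; case: ifP => vb; rewrite /toggle !inE eqxx /=.
  exact: setD1K.
by rewrite setU1K ?vb.
Qed.

Lemma toggle_act b v g : actC (toggle b v) g = toggle (actC b g) (actS v g).
Proof.
apply/setP => u; rewrite -(actKV actS g u) mem_actC /toggle mem_actC.
by case: ifP; rewrite !inE mem_actC (inj_eq (act_inj _ g)).
Qed.

Lemma toggle_D1 b v : toggle b v :\ v = b :\ v.
Proof.
rewrite /toggle; case: ifP => vb; apply/setP => u; rewrite !inE; first by case: eqP.
by case: eqP.
Qed.

(** An arbitrary representative of the face r together with its pivot; the
    default is never reached on faces of the link. *)
Definition pivot_of (r : {set {set {set 'I_n}}}) :=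
  odflt (c, S, T) [pick p | (p.1.1 \in r) && pivot p.1.1 p.1.2 p.2].

Definition match_face r :=
  let: (b, w, v) := pivot_of r in orb (toggle b v).

(** Lexicographic: first the number of members besides v, then the smallness
    of w, which is at most n. *)
Definition height r : nat :=
  let: (b, w, v) := pivot_of r in (#|b :\ v| * n.+1 + (n - #|w|))%N.

Lemma pivot_ofP b w v : pivot b w v -> exists b' w' v',
  [/\ pivot_of (orb b) = (b', w', v'), pivot b' w' v' & orb b = orb b'].
Proof.
move=> p; rewrite /pivot_of; case: pickP => [[[b' w'] v'] /= /andP[b'r p']|].
  exists b', w', v'; split=> //; apply/eqP/orb_eqP.
  exact/mem_orb.
by move/(_ (b, w, v)); rewrite /= p orbit_refl.
Qed.

Lemma match_faceE b w v : pivot b w v -> match_face (orb b) = orb (toggle b v).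
Proof.
move=> p; have [b' [w' [v' [e p' eo]]]] := pivot_ofP p.
have [g [gG eb _ ev]] := pivot_uniq p p' eo.
by rewrite /match_face e -eb -ev -toggle_act orb_act.
Qed.

Lemma heightE b w v : pivot b w v ->
  height (orb b) = (#|b :\ v| * n.+1 + (n - #|w|))%N.
Proof.
move=> p; have [b' [w' [v' [e p' eo]]]] := pivot_ofP p.
have [g [gG eb ew ev]] := pivot_uniq p p' eo.
rewrite /height e -ew card_setact; congr (_ * _ + _)%N.
suff -> : b' :\ v' = actC (b :\ v) g by rewrite card_setact.
apply/setP => u; rewrite -(actKV actS g u) -eb -ev mem_actC !inE mem_actC.
by rewrite (inj_eq (act_inj _ g)).
Qed.

Lemma link_pivot r : r \in link G (orb c) ->
  exists b w v, pivot b w v /\ r = orb b.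
Proof.
by move/mem_link=> [b ob ->]; have [w [v p]] := pivot_exists ob; exists b, w, v.
Qed.

Lemma card_proper_D1 b b' w : b \proper b' -> #|b| <= #|b' :\ w|.
Proof.
move=> /proper_card; rewrite (cardsD1 w b'); case: (w \in b') => /=.
  by rewrite add1n ltnS.
by rewrite add0n => /ltnW.
Qed.

(** Acyclicity. If the heights agree in the first component, then s has a
    representative b' with just one more member than b, and this member must be
    v' unless w' is smaller than w; if w' = w, then v' serves as a transversal
    for b as well, and s is the mate of t by uniqueness of transversals. *)
Lemma height_link_lt : {in link G (orb c) &, forall t s,
  orbit_le t (match_face t) -> properly_contained (@orbit_le n) t s ->
  s != match_face t -> height t < height s}.
Proof.
move=> _ s /link_pivot[b [w [v [pv ->]]]] sK; rewrite (match_faceE pv) => le_t.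
have p := pivotP _ _ _ pv; have ob := pivot_over p.
case/andP=> ne /(link_le_up ob sK)[b' [ob' es sub]]; subst s => s_mu.
have vb : v \notin b.
  have [g _ [_ /subset_leq_card]] := orb_le_down ob (over_toggle pv) le_t.
  by rewrite card_setact /toggle (cardsD1 v b); case: ifP => //; rewrite add1n ltnn.
have [w' [v' pv']] := pivot_exists ob'; have p' := pivotP _ _ _ pv'.
rewrite (heightE pv) (heightE pv').
have -> : b :\ v = b by apply/setP => u; rewrite !inE; case: eqP => // ->; rewrite (negbTE vb).
have bb' : b \proper b' by rewrite properEneq sub andbT; apply: contraNneq ne => ->.
have ltn_height (x y i j : nat) : x < y -> i <= n -> (x * n.+1 + i < y * n.+1 + j)%N.
  move=> xy le_in; apply: leq_trans (leq_addr _ _).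
  by apply: leq_trans (leq_mul xy (leqnn n.+1)); rewrite mulSn addnC ltn_add2r.
have := card_proper_D1 v' bb'; rewrite leq_eqVlt => /predU1P[eb|lt_b]; last first.
  by apply: ltn_height; rewrite ?leq_subr.
rewrite -eb ltn_add2l.
have v'b' : v' \in b'.
  apply: contraTT (proper_card bb') => v'b'; rewrite -leqNgt eb.
  by rewrite (cardsD1 v' b') (negbTE v'b').
have w'w : w' \subset w.
  apply: (pivot_w_min p'); last exact: pivot_w_repeats p.
  exact: (subsetP (setUS [set S] sub)) (pivot_w_in p).
have le_wn : #|w| <= n by rewrite -[leqRHS]card_ord max_card.
case: (eqVneq w' w) => [ew|new]; last first.
  have lt_w : #|w'| < #|w| by rewrite proper_card // properEneq new.
  by rewrite ltn_sub2l // (leq_trans lt_w).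
case/negP: s_mu; rewrite eq_sym.
have pv2 : pivot b w v'.
  apply/pivotP; split; try by case: p.
  - exact: pivot_T p'.
  - by rewrite -ew; apply: pivot_w p'.
  - exact: pivot_squarefree p'.
  - by rewrite -ew; apply: pivot_letters p'.
  - by move=> u ub; apply: (pivot_nested p'); apply: (subsetP sub).
have [g [gG gb _ gv]] := pivot_swap pv pv2.
apply/orb_eqP; exists g => //; rewrite toggle_act gb gv /toggle.
have v'b : v' \notin b by rewrite -gv -gb mem_actC.
rewrite (negbTE v'b); apply/esym/eqP; rewrite eqEcard subUset sub1set v'b' sub /=.
by rewrite cardsU1 v'b (cardsD1 v' b') v'b' eb.
Qed.

Theorem link_collapsible : collapsible (@orbit_le n) (orb c) (link G (orb c)).
Proof.
apply: (@matching_collapsible _ _ _ _ _ _ _ _ match_face height).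
- exact: link_le_trans.
- exact: link_le_anti.
- exact/link_orb/over_c.
- exact: link_le_min.
- by move=> _ /link_pivot[b [w [v [p ->]]]]; rewrite (match_faceE p); apply/link_orb/over_toggle/p.
- move=> _ /link_pivot[b [w [v [p ->]]]].
  by rewrite (match_faceE p) (match_faceE (pivot_toggle p)) toggleK.
- move=> _ /link_pivot[b [w [v [p ->]]]]; rewrite (match_faceE p).
  apply/eqP => /card_orb; rewrite /toggle; case: ifP => vb.
    by rewrite [in RHS](cardsD1 v) vb add1n => /n_Sn.
  by rewrite cardsU1 vb add1n => /esym/n_Sn.
- move=> _ /link_pivot[b [w [v [p ->]]]]; rewrite (match_faceE p) /toggle.
  case: ifP => _; apply/orP; [right|left]; apply: orb_le; last exact: subsetUr.
  exact: subD1set.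
- move=> _ /link_pivot[b [w [v [p ->]]]] ne; rewrite (match_faceE p) => le_t.
  have ob := pivot_over (pivotP _ _ _ p); have [_ cb] := andP ob.
  rewrite (dim_link G ob) (dim_link G (over_toggle p)).
  have [g _ [_ /subset_leq_card]] := orb_le_down ob (over_toggle p) le_t.
  rewrite card_setact /toggle; case: ifP => vb; first by rewrite (cardsD1 v b) vb add1n ltnn.
  have lt_cb : #|c| < #|b|.
    rewrite proper_card // properEneq cb andbT; apply: contraNneq ne => -> //.
  by rewrite cardsU1 vb add1n subSn 1?ltnW //= prednK // subn_gt0.
- move=> _ /link_pivot[b [w [v [p ->]]]].
  by rewrite (match_faceE p) (heightE p) (heightE (pivot_toggle p)) toggle_D1.
- exact: height_link_lt.
Qed.

End Pivot.

(** * Rows and the wreath product *)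

Section Wreath.

Variables l m : nat.

Lemma row_index_subproof (x : 'I_(l * m)) : x %/ l < m.
Proof.
have l_gt0 : 0 < l by have := leq_ltn_trans (leq0n x) (ltn_ord x); rewrite muln_gt0 => /andP[].
by rewrite ltn_divLR // [leqRHS]mulnC ltn_ord.
Qed.

Definition row_index (x : 'I_(l * m)) : 'I_m := Ordinal (row_index_subproof x).

Lemma mem_letter_row x i : (x \in letter_row l i) = (row_index x == i).
Proof.
have l_gt0 : 0 < l by have := leq_ltn_trans (leq0n x) (ltn_ord x); rewrite muln_gt0 => /andP[].
by rewrite inE -leq_divRL // -ltn_divLR // ltnS andbC -eqn_leq -val_eqE.
Qed.

Lemma wreath_row_index (g : 'S_(l * m)) x y :
  g \in wreath l m -> row_index x = row_index y -> row_index (g x) = row_index (g y).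
Proof.
move=> gW exy; have R : letter_row l (row_index x) \in rows l m by apply: imset_f.
have := R; rewrite -(astabs_act _ gW) => /imsetP[j _ ej].
have in_j z : row_index z = row_index x -> row_index (g z) = j.
  by move=> ez; apply/eqP; rewrite -mem_letter_row -ej mem_actS mem_letter_row ez.
by rewrite !in_j.
Qed.

Lemma row_stabiliser_wreath (g : 'S_(l * m)) :
  (forall x, row_index (g x) = row_index x) -> g \in wreath l m.
Proof.
move=> gl; rewrite inE in_setT inE /=; apply/subsetP => _ /imsetP[i _ ->].
rewrite inE actS_fix ?imset_f // => x.
by rewrite !mem_letter_row gl.
Qed.

End Wreath.

Theorem proposition4p1 (l m : nat) (hl : 1 <= l) (hm : 1 <= m)
    (sigma : {set {set {set 'I_(l * m)}}})
    (hsigma : sigma \in quotient_faces (wreath l m))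
    (T S S' : {set 'I_(l * m)})
    (homit : omits_single_interval sigma T S)
    (hS : S = T :|: S') (hdisj : [disjoint T & S'])
    (hmult : exists j : 'I_m, 1 < multiplicity j S') :
  collapsible (@orbit_le (l * m)) sigma (link (wreath l m) sigma).
Proof.
case: homit => c c_sigma [T_in S_in _ consecutive _].
have [c_chain ->] : c \in Delta (l * m) /\ sigma = orbit ('P^*^*) (wreath l m) c.
  case/imsetP: hsigma c_sigma => c0 c0D ->; case/mem_orb => g gW ->.
  by rewrite Delta_act // orb_act.
apply: (@link_collapsible _ _ (@row_index l m) _ _ _ c _ T S) => //.
- exact: wreath_row_index.
- exact: row_stabiliser_wreath.
have [j] := hmult; case/card_gt1P => x [y [/setIP[xS' xj] /setIP[yS' yj] xy]].
have S'P z : z \in S' -> z \in S :\: T.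
  by move=> zS'; rewrite hS !inE zS' orbT andbT (disjointFl hdisj).
apply: contra xy => /squarefreeP inj; apply/eqP; apply: inj; rewrite ?S'P //.
by move: xj yj; rewrite !mem_letter_row => /eqP-> /eqP->.
Qed.
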